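(* Let $R$ be a finite set of non-negative integers and let $\alpha\in[0,|R|)$. Then $\alpha$ is a non-jump for $R$ (i.e. not a jump for $R$) if and only if $\alpha$ is the limit of a strictly decreasing sequence $\alpha_1>\alpha_2>\cdots$ of values each of which is not a strong jump for $R$.
   Context: A hypergraph is a pair $H=(V,E)$ with $E\subseteq 2^V$; $H$ is an $R$-graph if $|e|\in R$ for every $e\in E$. For an $R$-graph $H$ on $n$ vertices, $h_n(H)=\sum_{e\in E(H)} 1/\binom{n}{|e|}$. A value $\alpha\in[0,|R|]$ is a jump for $R$ if there exists $c>0$ such that for every $\epsilon>0$ and every integer $t\ge\max R$ there is $n_0$ such that whenever $n\ge n_0$ and $G_n$ is an $R$-graph on $n$ vertices with $h_n(G_n)\ge\alpha+\epsilon$, $G_n$ contains a subgraph $H_t$ on $t$ vertices with $h_t(H_t)\ge\alpha+c$. A value $\alpha\in[0,|R|]$ is a strong jump for $R$ if there exists $c>0$ such that for every integer $t\ge\max R$ there is $n_0$ such that whenever $n\ge n_0$ and $G_n$ is an $R$-graph on $n$ vertices with $h_n(G_n)\ge\alpha-c$, $G_n$ contains a subgraph $H_t$ on $t$ vertices with $h_t(H_t)\ge\alpha+c$. *)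

(* Defs.v *)
From HB Require Import structures.
From mathcomp Require Import all_boot all_order all_algebra finmap.
From mathcomp Require Import all_classical all_reals all_analysis.

Set Implicit Arguments.
Unset Strict Implicit.
Unset Printing Implicit Defensive.

Import Order.TTheory GRing.Theory Num.Theory.
Import numFieldNormedType.Exports.

Local Open Scope ring_scope.

(* The vertex set is a subset of an ambient finite type T rather than T itself,
   so that a hypergraph and its subgraphs live in the same type. *)
Record hypergraph (T : finType) := Hypergraph {
  vertices : {set T};
  edges : {set {set T}};
  edges_sub : edges \subset powerset vertices
}.

Definition is_Rgraph (R : {fset nat}) (T : finType) (H : hypergraph T) : Prop :=
  forall e : {set T}, e \in edges H -> #|e| \in R.

Definition subgraph (T : finType) (H G : hypergraph T) : Prop :=
  vertices H \subset vertices G /\ edges H \subset edges G.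

Definition hn (K : realType) (T : finType) (H : hypergraph T) : K :=
  \sum_(e in edges H) 1 / 'C(#|vertices H|, #|e|)%:R.

Definition maxR (R : {fset nat}) : nat := \max_(r <- enum_fset R) r.

Definition jump (K : realType) (R : {fset nat}) (alpha : K) : Prop :=
  0 <= alpha <= #|` R|%:R /\
  exists c : K, 0 < c /\
    forall (eps : K) (t : nat), 0 < eps -> (maxR R <= t)%N ->
    exists n0 : nat, forall n : nat, (n0 <= n)%N ->
    forall (T : finType) (G : hypergraph T),
      is_Rgraph R G -> #|vertices G| = n -> alpha + eps <= hn K G ->
      exists H : hypergraph T,
        subgraph H G /\ #|vertices H| = t /\ alpha + c <= hn K H.

Definition strong_jump (K : realType) (R : {fset nat}) (alpha : K) : Prop :=
  0 <= alpha <= #|` R|%:R /\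
  exists c : K, 0 < c /\
    forall t : nat, (maxR R <= t)%N ->
    exists n0 : nat, forall n : nat, (n0 <= n)%N ->
    forall (T : finType) (G : hypergraph T),
      is_Rgraph R G -> #|vertices G| = n -> alpha - c <= hn K G ->
      exists H : hypergraph T,
        subgraph H G /\ #|vertices H| = t /\ alpha + c <= hn K H.

(* Main.v *)
(* If [alpha] is a jump with gap [c], every [beta] in the open interval
   [(alpha, alpha + c)] is a strong jump.  Conversely, if [alpha] is not a jump,
   then for every [c > 0] there is a [t] such that arbitrarily large R-graphs of
   density at least [alpha + eps] have no [t]-vertex subgraph of density
   [alpha + c].  Let [p] be the limsup of the densities of the graphs in this
   hereditary class.  Averaging over [t]-subsets gives [p <= alpha + c]; and [p]
   is not a strong jump, since otherwise subgraphs of near-optimal members of the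
   class would be members of density at least [p + c'] on any number of vertices.
   So non-strong-jumps accumulate at [alpha] from above. *)
Require Import Defs.
From HB Require Import structures.
From mathcomp Require Import all_boot all_order all_algebra finmap.
From mathcomp Require Import all_classical all_reals all_analysis.
From mathcomp Require Import lra.

Import Order.TTheory GRing.Theory Num.Theory.
Import numFieldNormedType.Exports.

Local Open Scope classical_set_scope.
Local Open Scope ring_scope.

Lemma subgraph_trans (T : finType) (F G H : hypergraph T) :
  subgraph H G -> subgraph G F -> subgraph H F.
Proof.
move=> [vHG eHG] [vGF eGF].
by split; [exact: fintype.subset_trans vGF|exact: fintype.subset_trans eGF].
Qed.

Lemma subgraph_is_Rgraph (R : {fset nat}) (T : finType) (G H : hypergraph T) :
  subgraph H G -> is_Rgraph R G -> is_Rgraph R H.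
Proof. by move=> [_ /fintype.subsetP eHG] RG e /eHG/RG. Qed.

Lemma maxR_ge (R : {fset nat}) (r : nat) : r \in R -> (r <= maxR R)%N.
Proof. by move=> rR; exact: (leq_bigmax_seq (F := fun r => r)). Qed.

Lemma delete_vertex_subproof (T : finType) (G : hypergraph T) (v : T) :
  [set e in edges G | v \notin e]%SET \subset powerset (vertices G :\ v)%SET.
Proof.
apply/fintype.subsetP => e; rewrite !inE => /andP[eG ve].
by rewrite subsetD1 ve andbT -powersetE (fintype.subsetP (edges_sub G)).
Qed.

Definition delete_vertex (T : finType) (G : hypergraph T) (v : T) :
  hypergraph T := Hypergraph (delete_vertex_subproof T G v).

Lemma subgraph_delete_vertex (T : finType) (G : hypergraph T) (v : T) :
  subgraph (delete_vertex T G v) G.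
Proof.
split; first exact: subD1set.
by apply/fintype.subsetP => e; rewrite inE => /andP[].
Qed.

Lemma card_delete_vertex (T : finType) (G : hypergraph T) (v : T) (n : nat) :
  #|vertices G| = n.+1 -> v \in vertices G ->
  #|vertices (delete_vertex T G v)| = n.
Proof.
by move=> Vn vV; apply/eqP; rewrite -eqSS -Vn [eqbRHS](cardsD1 v) vV.
Qed.

(** Double counting: an edge [e] survives the deletion of exactly the [n.+1 - #|e|] vertices outside
    it, and [(n.+1 - #|e|) * 'C(n.+1, #|e|) = n.+1 * 'C(n, #|e|)]. The bound on [#|e|] keeps both
    binomials nonzero. *)
Lemma sum_hn_delete_vertex (K : realType) (T : finType) (G : hypergraph T)
    (n : nat) :
  #|vertices G| = n.+1 -> (forall e, e \in edges G -> (#|e| <= n)%N) ->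
  \sum_(v in vertices G) hn K (delete_vertex T G v) = n.+1%:R * hn K G.
Proof.
move=> Vn en.
have hnD v : v \in vertices G -> hn K (delete_vertex T G v) =
    \sum_(e in edges G | v \notin e) 1 / 'C(n, #|e|)%:R.
  move=> vV; rewrite /hn (card_delete_vertex _ _ _ n) //.
  by apply: eq_bigl => e; rewrite inE.
rewrite (eq_bigr _ hnD) (exchange_big_dep (mem (edges G))) /=; last first.
  by move=> v e _ /andP[].
rewrite /hn mulr_sumr; apply: eq_bigr => e eG.
rewrite sumr_const.
have -> : #|[pred v in vertices G | (e \in edges G) && (v \notin e)]| =
          (n.+1 - #|e|)%N.
  have eV : e \subset vertices G.
    by rewrite -powersetE (fintype.subsetP (edges_sub G)).
  rewrite -Vn -(cardsDS eV) -[RHS]cardsE; apply: eq_card => v.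
  by rewrite !inE eG andbC.
rewrite Vn -[LHS]mulr_natl !mul1r.
have C0 m : (#|e| <= m)%N -> 'C(m, #|e|)%:R != 0 :> K.
  by move=> em; rewrite pnatr_eq0 -lt0n bin_gt0.
apply/eqP; rewrite eqr_div ?C0 ?en ?(leqW (en _ eG)) //.
by rewrite -!natrM eqr_nat mul_bin_down.
Qed.

Lemma ex_subgraph_hn_ge_pred (K : realType) (T : finType) (G : hypergraph T)
    (n : nat) :
  #|vertices G| = n.+1 -> (forall e, e \in edges G -> (#|e| <= n)%N) ->
  exists H, [/\ subgraph H G, #|vertices H| = n & hn K G <= hn K H].
Proof.
move=> Vn en; apply: contrapT => noH.
have lt v : v \in vertices G -> hn K (delete_vertex T G v) < hn K G.
  move=> vV; rewrite ltNge; apply/negP => le; apply: noH.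
  exists (delete_vertex T G v); split => //; first exact: subgraph_delete_vertex.
  exact: card_delete_vertex.
have [v vV] : exists v, v \in vertices G by apply/card_gt0P; rewrite Vn.
suff : \sum_(v in vertices G) hn K (delete_vertex T G v) <
       \sum_(v in vertices G) hn K G.
  by rewrite (sum_hn_delete_vertex K _ _ n) // sumr_const Vn mulr_natl ltxx.
(* One vertex is split off to make the inequality between the sums strict. *)
rewrite (bigD1 v) //= [ltRHS](bigD1 v) //=.
apply: ltr_leD; first exact: lt.
by apply: ler_sum => w /andP[/lt/ltW].
Qed.

(** Vertices are deleted one at a time without losing density; [maxR R <= t] ensures that no edge is
    larger than the vertex set left after a deletion. *)
Lemma ex_subgraph_hn_ge (K : realType) (R : {fset nat}) (T : finType)
    (G : hypergraph T) (t : nat) :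
  is_Rgraph R G -> (maxR R <= t <= #|vertices G|)%N ->
  exists H, [/\ subgraph H G, #|vertices H| = t & hn K G <= hn K H].
Proof.
move=> RG /andP[Rt tG].
move: {2}(#|vertices G| - t)%N (erefl (#|vertices G| - t)%N) => k.
elim: k G RG tG => [|k IHk] G RG tG kE.
  exists G; split=> //.
  by apply/eqP; rewrite eqn_leq tG andbT -subn_eq0 kE.
have Vk : #|vertices G| = (t + k).+1 by rewrite -addnS -kE subnKC.
have [e eG|H [HG Hk GH]] := ex_subgraph_hn_ge_pred K _ _ _ Vk.
  by rewrite (leq_trans (maxR_ge _ _ (RG _ eG))) // (leq_trans Rt) ?leq_addr.
have [||H' [H'H H't HH']] := IHk H (subgraph_is_Rgraph _ _ _ _ HG RG).
- by rewrite Hk leq_addr.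
- by rewrite Hk addKn.
exists H'; split => //; first exact: subgraph_trans HG.
exact: le_trans HH'.
Qed.

Definition all_subgraphs_sparse (K : realType) (T : finType) (G : hypergraph T)
    (t : nat) (x : K) : Prop :=
  forall H, subgraph H G -> #|vertices H| = t -> hn K H < x.

(** When this set is nonempty, its supremum is the limsup of the densities in the hereditary
    class. *)
Definition sparse_densities (K : realType) (R : {fset nat}) (t : nat) (x : K) :
    set K :=
  [set y | forall n0 : nat, exists (T : finType) (G : hypergraph T),
    [/\ is_Rgraph R G, (n0 <= #|vertices G|)%N, y <= hn K G &
        all_subgraphs_sparse K T G t x]].

Lemma sparse_densities_ub (K : realType) (R : {fset nat}) (t : nat) (x : K) :
  (maxR R <= t)%N -> ubound (sparse_densities K R t x) x.
Proof.
move=> Rt y /(_ t)[T [G [RG tG yG Gx]]].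
have [|H [HG Ht GH]] := ex_subgraph_hn_ge K R T G t RG; first by rewrite Rt.
exact: ltW (le_lt_trans yG (le_lt_trans GH (Gx _ HG Ht))).
Qed.

Lemma sup_sparse_densities_not_strong_jump (K : realType) (R : {fset nat})
    (t : nat) (x : K) :
  (maxR R <= t)%N -> sparse_densities K R t x !=set0 ->
  ~ strong_jump R (sup (sparse_densities K R t x)).
Proof.
move=> Rt S0; set S := sparse_densities K R t x in S0 *.
have supS : has_sup S by split=> //; exists x; exact: sparse_densities_ub.
move=> [_ [c [c0 sj]]].
suff /(ub_le_sup (proj2 supS)) : S (sup S + c) by lra.
(* The subgraph needs at least [n0] vertices to witness membership in [S], and at least [maxR R] for
   the strong jump to apply. *)
move=> n0; have [n1 {}sj] := sj (maxn n0 (maxR R)) (leq_maxr _ _).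
have [y /(_ n1)[T [G [RG n1G yG Gx]]] supy] := sup_adherent c0 supS.
have [|H [HG [Hn pH]]] := sj _ n1G T G RG erefl.
  by rewrite (le_trans (ltW supy)).
exists T, H; split => //; first exact: subgraph_is_Rgraph RG.
  by rewrite Hn leq_maxl.
by move=> F FH; apply: Gx; exact: subgraph_trans HG.
Qed.

Lemma not_jump_sparse (K : realType) (R : {fset nat}) (alpha c : K) :
  0 <= alpha <= #|` R|%:R -> ~ jump R alpha -> 0 < c ->
  exists (eps : K) (t : nat), [/\ 0 < eps, (maxR R <= t)%N &
    sparse_densities K R t (alpha + c) (alpha + eps)].
Proof.
move=> alphaR nj c0; apply: contrapT => nS; apply: nj; split => //.
exists c; split => // eps t eps0 Rt; apply: contrapT => nn0; apply: nS.
exists eps, t; split => // n0; apply: contrapT => nG; apply: nn0.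
exists n0 => n n0n T G RG Gn aG; apply: contrapT => nH; apply: nG.
exists T, G; split => //; first by rewrite Gn.
move=> H HG Ht; rewrite ltNge; apply/negP => le; apply: nH.
by exists H.
Qed.

Lemma not_jump_ex_not_strong_jump (K : realType) (R : {fset nat})
    (alpha c : K) :
  0 <= alpha <= #|` R|%:R -> ~ jump R alpha -> 0 < c ->
  exists p : K, alpha < p <= alpha + c /\ ~ strong_jump R p.
Proof.
move=> alphaR nj c0.
have [eps [t [eps0 Rt Seps]]] := not_jump_sparse K R alpha c alphaR nj c0.
have S0 : sparse_densities K R t (alpha + c) !=set0 by exists (alpha + eps).
have ubS := sparse_densities_ub K R t (alpha + c) Rt.
(* The element [alpha + eps] puts the supremum strictly above [alpha]; averaging bounds it by
   [alpha + c]. *)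
exists (sup (sparse_densities K R t (alpha + c))); split.
  apply/andP; split; last exact: ge_sup.
  apply: (@lt_le_trans _ _ (alpha + eps)); first by rewrite ltrDl.
  by apply: ub_le_sup => //; exists (alpha + c).
exact: sup_sparse_densities_not_strong_jump.
Qed.

Lemma jump_strong_jump_right (K : realType) (R : {fset nat}) (alpha : K) :
  jump R alpha -> exists c : K, 0 < c /\
    forall b : K, alpha < b < alpha + c -> b <= #|` R|%:R -> strong_jump R b.
Proof.
move=> [/andP[alpha0 _] [c [c0 jc]]]; exists c; split => // b /andP[ab bc] bR.
split; first by rewrite bR andbT; lra.
(* Going down from [b] by this amount stays at least [(b - alpha) / 2] above [alpha], which serves
   as [eps]; going up stays within [alpha + c]. *)
exists (Num.min ((b - alpha) / 2) (alpha + c - b)); split.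
  by rewrite lt_min; apply/andP; split; lra.
move=> t Rt; have [|n0 {}jc] := jc ((b - alpha) / 2) t _ Rt; first by lra.
exists n0 => n n0n T G RG Gn bG.
have [|H [HG [Ht aH]]] := jc n n0n T G RG Gn.
  apply: le_trans bG.
  have : Num.min ((b - alpha) / 2) (alpha + c - b) <= (b - alpha) / 2.
    by rewrite ge_min lexx.
  by lra.
exists H; do 2!split => //; apply: le_trans aH.
have : Num.min ((b - alpha) / 2) (alpha + c - b) <= alpha + c - b.
  by rewrite ge_min lexx orbT.
by lra.
Qed.

Lemma decreasing_seq_gt_lim (K : realType) (a : nat -> K) (l : K) :
  decreasing_seq a -> a @ \oo --> l -> forall i, l < a i.
Proof.
move=> /decreasing_seqP da al i; apply: le_lt_trans (da i).
have nia : nonincreasing_seq a.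
  by apply/nonincreasing_seqP => n; exact: ltW (da n).
rewrite -(cvg_lim _ al) //; apply: nonincreasing_cvgn_ge => //.
by apply/cvg_ex; exists l.
Qed.

Lemma ex_decreasing_seq_cvg (K : realType) (P : K -> Prop) (l : K) :
  (forall c, 0 < c -> exists p, l < p <= l + c /\ P p) ->
  forall c, 0 < c -> exists a : nat -> K,
    [/\ decreasing_seq a, forall i, l < a i <= l + c, forall i, P (a i) &
        a @ \oo --> l].
Proof.
move=> Pacc c c0.
have /choice[f fP] : forall c : K, exists p, 0 < c -> l < p <= l + c /\ P p.
  move=> d; have [d0|d0] := ltP 0 d; last by exists 0.
  by have [p] := Pacc d d0; exists p.
(* Each term at least halves the distance to [l], which gives both strict decrease and geometric
   convergence. *)
pose a := fix a i := if i is j.+1 then f ((a j - l) / 2) else f c.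
have la i : l < a i.
  elim: i => [|i IHi] /=; first by have [/andP[]] := fP _ c0.
  by have [|/andP[]//] := fP ((a i - l) / 2); lra.
have aS i : a i.+1 <= l + (a i - l) / 2.
  by have /= [|/andP[]//] := fP ((a i - l) / 2); move: (la i); lra.
have ac i : a i <= l + c / 2 ^+ i.
  elim: i => [|i IHi]; first by rewrite expr0 divr1; have [/andP[]] := fP _ c0.
  apply: le_trans (aS i) _; rewrite exprSr invfM mulrA; lra.
have da i : a i.+1 < a i by move: (aS i) (la i); lra.
exists a; split.
- exact/decreasing_seqP.
- move=> i; rewrite la (le_trans (ac i)) // lerD2l ler_pdivrMr ?exprn_gt0 //.
  by rewrite ler_peMr ?exprn_ege1 ?ler1n ?ltW.
- case=> [|i] /=; first by have [] := fP _ c0.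
  by have [|_ //] := fP ((a i - l) / 2); move: (la i); lra.
- apply: (@squeeze_cvgr _ _ _ _ (cst l) (fun i => l + c / 2 ^+ i)).
  + by apply: nearW => i; rewrite ac ltW.
  + exact: cvg_cst.
  + rewrite -[X in _ --> X]addr0; apply: cvgD; first exact: cvg_cst.
    rewrite -[X in _ --> X](mulr0 c); apply: cvgM; first exact: cvg_cst.
    under eq_fun do rewrite -exprVn.
    by apply: cvg_expr; rewrite ger0_norm ?invr_ge0 // invf_lt1 // ltr1n.
Qed.

Theorem theorem2 (K : realType) (R : {fset nat}) (alpha : K)
    (halpha : 0 <= alpha < #|` R|%:R) :
  ~ jump R alpha <->
  exists a : nat -> K,
    [/\ decreasing_seq a,
        forall i : nat, 0 <= a i <= #|` R|%:R,
        forall i : nat, ~ strong_jump R (a i)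
      & a @ \oo --> alpha].
Proof.
have /andP[alpha0 alphaR] := halpha; split.
  move=> nj.
  have alphaR' : 0 <= alpha <= #|` R|%:R by rewrite alpha0 ltW.
  have acc c : 0 < c ->
      exists p : K, alpha < p <= alpha + c /\ ~ strong_jump R p.
    exact: not_jump_ex_not_strong_jump.
  (* Taking the initial gap to be [#|R| - alpha], positive since [alpha < #|R|], keeps every term
     within the admissible range. *)
  have [|a [da aR aP acvg]] :=
    ex_decreasing_seq_cvg K _ alpha acc (#|` R|%:R - alpha).
    by rewrite subr_gt0.
  by exists a; split => // i; have /andP[] := aR i; rewrite addrC subrK; lra.
move=> [a [da aR aP acvg]] /jump_strong_jump_right[c [c0 cP]].
(* Convergence from strictly above puts some [a N] in the interval where every value is a strong
   jump. *)
have [N _ /(_ N (leqnn N)) /= Nc] : \forall i \near \oo, a i < alpha + c.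
  by apply: (cvgr_lt alpha) => //; rewrite ltrDl.
apply: (aP N); apply: cP; last by have /andP[] := aR N.
by rewrite Nc andbT; exact: decreasing_seq_gt_lim.
Qed.
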